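(* Let $\mathcal{S}:H^p(\mathbb{S}^2)\to H^r(\mathbb{S}^2)$ be a continuous operator that is diagonalizable in the orthonormal basis $(Y_\ell^m)_{0\le\ell,\,-\ell\le m\le\ell}$ of spherical harmonics, with eigenvalues $s_\ell$ depending only on $\ell$: $$\mathcal{S}Y_\ell^m=s_\ell Y_\ell^m\qquad\text{for all }0\le\ell,\ -\ell\le m\le \ell .$$ Then the operator $\mathcal{S}_n:L^2(\mathbb{S}^2)\to L^2(\mathbb{S}^2)$ defined as $$\mathcal{S}_n\psi:=\hat{x}\cdot\mathcal{S}\left[\hat{x}\,\psi\right],\qquad \psi\in L^2(\mathbb{S}^2),$$ is also diagonalizable in the orthonormal basis $(Y_\ell^m)_{0\le\ell,\,-\ell\le m\le\ell}$, with $$\mathcal{S}_nY_\ell^m=s_{n,\ell}\,Y_\ell^m\qquad\text{for all }0\le\ell,\ -\ell\le m\le \ell,$$ where $$s_{n,\ell}:=\begin{cases}s_{\ell+1}, & \ell=0,\\[2pt] \dfrac{\ell}{2\ell+1}\,s_{\ell-1}+\dfrac{\ell+1}{2\ell+1}\,s_{\ell+1}, & 1\le\ell.\end{cases}$$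
   Context: $\mathbb{S}^2\subset\mathbb{R}^3$ is the unit sphere and $H^s(\mathbb{S}^2)$ denotes the Sobolev space of order $s$ on $\mathbb{S}^2$; $p$ and $r$ are Sobolev indices. A point of $\mathbb{S}^2$ is written $\hat{x}=(x_1,x_2,x_3)=(\cos\varphi\sin\theta,\sin\varphi\sin\theta,\cos\theta)$. The operator $\mathcal{S}$ is applied componentwise to vector-valued functions, so that $\hat{x}\cdot\mathcal{S}[\hat{x}\psi]=\sum_{j=1}^3x_j\,\mathcal{S}[x_j\psi]$. Spherical harmonics: for $\ell\ge0$ and $-\ell\le m\le\ell$, $$Y_\ell^m(\hat{x})=\gamma_\ell^m e^{im\varphi}\,\mathbb{P}_\ell^{|m|}(\cos\theta),\qquad \gamma_\ell^m:=\left[\frac{\ell+\frac12}{2\pi}\,\frac{(\ell-|m|)!}{(\ell+|m|)!}\right]^{1/2},$$ where, for $0\le m\le\ell$, $\mathbb{P}_\ell^m(\cos\theta)=(-1)^m(\sin\theta)^m\left(\frac{d}{dx}\right)^m\mathbb{P}_\ell(x)\big|_{x=\cos\theta}$ and $\mathbb{P}_\ell$ is the Legendre polynomial of degree $\ell$. The family $(Y_\ell^m)$ is an orthonormal basis of $L^2(\mathbb{S}^2)$. *)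

(* Defs.v *)
From HB Require Import structures.
From mathcomp Require Import all_boot all_order all_algebra.
From mathcomp Require Import all_classical all_reals all_analysis.
From mathcomp Require Import complex ring lra.

Set Implicit Arguments.
Unset Strict Implicit.
Unset Printing Implicit Defensive.

Import Order.TTheory GRing.Theory Num.Theory.
Import numFieldNormedType.Exports.

Local Open Scope classical_set_scope.
Local Open Scope ring_scope.
Local Open Scope complex_scope.

Section Sphere.
Variable R : realType.

Definition sphere := {x : 'rV[R]_3 | \sum_j x 0 j ^+ 2 == 1}.

Definition xcoord (j : 'I_3) (x : sphere) : R[i] := (val x 0 j)%:C.

Definition spherical_row (t : R * R) : 'rV[R]_3 :=
  \row_j [:: cos t.2 * sin t.1; sin t.2 * sin t.1; cos t.1]`_j.

Fact spherical_rowP t : \sum_j spherical_row t 0 j ^+ 2 == 1.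
Proof.
rewrite !big_ord_recl big_ord0 !mxE /=; apply/eqP.
have h1 := cos2Dsin2 t.1; have h2 := cos2Dsin2 t.2.
transitivity ((cos t.2 ^+ 2 + sin t.2 ^+ 2) * sin t.1 ^+ 2 + cos t.1 ^+ 2).
  by ring.
by rewrite h2 mul1r addrC.
Qed.

(* [t = (theta, phi)]: colatitude first, then azimuth. *)
Definition of_angles (t : R * R) : sphere := exist _ (spherical_row t) (spherical_rowP t).

Definition angle_space := (measurableTypeR R * measurableTypeR R)%type.

Definition angle_box : set angle_space := `[0, pi] `*` `[0, 2 * pi].

(* At the poles the azimuth is arbitrary. *)
Definition angles (x : sphere) : R * R :=
  xget (0, 0) [set t | [/\ 0 <= t.1 <= pi, 0 <= t.2 < 2 * pi & of_angles t = x]].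

Fact sqr_le1 (c : R) : c ^+ 2 <= 1 -> -1 <= c <= 1.
Proof. by move=> c1; rewrite -ler_norml -(@expr_le1 _ 2) // real_normK ?num_real. Qed.

Fact angles_ex x : exists t : R * R,
  [/\ 0 <= t.1 <= pi, 0 <= t.2 < 2 * pi & of_angles t = x].
Proof.
case: x => v hv; have := hv; rewrite !big_ord_recl big_ord0 addr0 => /eqP.
set a := v 0 ord0; set b := v 0 (lift ord0 ord0).
set c := v 0 (lift ord0 (lift ord0 ord0)) => h.
have a0 := sqr_ge0 a; have b0 := sqr_ge0 b.
have c1 : -1 <= c <= 1 by apply: sqr_le1; lra.
have pi0 : (0 : R) < pi := pi_gt0 R.
set r := Num.sqrt (1 - c ^+ 2).
have r2 : r ^+ 2 = a ^+ 2 + b ^+ 2 by rewrite sqr_sqrtr; lra.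
have r0 : 0 <= r by exact: sqrtr_ge0.
suff [phi [phi0 ha hb]] : exists phi : R,
    [/\ 0 <= phi < 2 * pi, cos phi * r = a & sin phi * r = b].
  exists (acos c, phi); split=> //=.
    by rewrite acos_ge0 // acos_lepi.
  apply: val_inj => /=; apply/rowP => j; rewrite mxE /= sin_acos //.
  rewrite -/r ha hb acosK ?in_itv //=.
  case: j => -[|[|[|//]]] hj /=; congr (v 0 _); exact: val_inj.
have [r_eq0|r_neq0] := eqVneq r 0.
  move: r2; rewrite r_eq0 expr0n /= => /esym/eqP.
  rewrite paddr_eq0 ?sqr_ge0 // !sqrf_eq0 => /andP[/eqP -> /eqP ->].
  by exists 0; rewrite lexx mulr_gt0 // !mulr0.
have rgt0 : 0 < r by rewrite lt_neqAle eq_sym r_neq0.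
have cd : (a / r) ^+ 2 + (b / r) ^+ 2 = 1.
  by rewrite !expr_div_n -mulrDl -r2 divff // expf_neq0.
have c1' : -1 <= a / r <= 1 by apply: sqr_le1; have := sqr_ge0 (b / r); lra.
have sE : Num.sqrt (1 - (a / r) ^+ 2) = `|b / r|.
  by rewrite -cd addrAC subrr add0r sqrtr_sqr.
have {b0}[b0|b0] := leP 0 b.
  exists (acos (a / r)); split.
  - rewrite acos_ge0 //=; apply: le_lt_trans (acos_lepi c1') _.
    by lra.
  - by rewrite acosK ?in_itv //= divfK.
  - by rewrite sin_acos // sE ger0_norm ?divr_ge0 // divfK.
have ca : cos (acos (a / r)) = a / r by rewrite acosK ?in_itv.
have sa : sin (acos (a / r)) = - (b / r).
  by rewrite sin_acos // sE ltr0_norm // pmulr_llt0 ?invr_gt0.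
have agt0 : 0 < acos (a / r).
  rewrite lt_neqAle acos_ge0 // andbT; apply/eqP => a1.
  move: sa; rewrite -a1 sin0 => /esym/eqP.
  by rewrite oppr_eq0 mulf_eq0 invr_eq0 (negbTE r_neq0) (lt_eqF b0).
have lepi := acos_lepi c1'.
exists (pi *+ 2 - acos (a / r)); split.
- by rewrite -mulr_natl; apply/andP; split; lra.
- by rewrite addrC cosD2pi cosN ca divfK.
- by rewrite addrC sinD2pi sinN sa opprK divfK.
Qed.

Fact anglesK : cancel angles of_angles.
Proof. by move=> x; have [] := xgetPex (0, 0) (angles_ex x). Qed.

(* Rodrigues' formula *)
Definition legendre (l : nat) : {poly R} :=
  (2 ^+ l * l`!%:R)^-1 *: (('X^2 - 1) ^+ l)^`(l).

(* [P_l^k (cos theta)], with the Condon-Shortley sign *)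
Definition assoc_legendre (l k : nat) (theta : R) : R :=
  (-1) ^+ k * sin theta ^+ k * ((legendre l)^`(k)).[cos theta].

Definition harmonic_norm (l k : nat) : R :=
  Num.sqrt ((l%:R + 2^-1) / (2 * pi) * ((l - k)`!%:R / (l + k)`!%:R)).

Definition cis (a : R) : R[i] := cos a +i* sin a.

(* The spherical harmonic of degree [l] and order [m], meant for [|m| <= l] *)
Definition Ylm (l : nat) (m : int) (x : sphere) : R[i] :=
  let: (theta, phi) := angles x in
  (harmonic_norm l `|m|%N)%:C * cis (m%:~R * phi)
    * (assoc_legendre l `|m|%N theta)%:C.

(* The algebra of functions generated by the constants and the coordinates. *)
Inductive polynomial_fun : (sphere -> R[i]) -> Prop :=
| polynomial_cst (c : R[i]) : polynomial_fun (cst c)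
| polynomial_coord j : polynomial_fun (xcoord j)
| polynomial_add f g : polynomial_fun f -> polynomial_fun g -> polynomial_fun (f + g)
| polynomial_mul f g : polynomial_fun f -> polynomial_fun g -> polynomial_fun (f * g).

Definition polynomial_pred : {pred sphere -> R[i]} := fun f => `[< polynomial_fun f >].

Fact polynomialZ c f : polynomial_fun f -> polynomial_fun (c *: f).
Proof.
move=> hf; have -> : c *: f = cst c * f by [].
by apply: polynomial_mul => //; exact: polynomial_cst.
Qed.

Fact polynomial_submod : submod_closed polynomial_pred.
Proof.
split=> [|c f g /asboolP hf /asboolP hg]; apply/asboolP.
  exact: (polynomial_cst 0).
by apply: polynomial_add => //; exact: polynomialZ.
Qed.

HB.instance Definition _ := GRing.isSubmodClosed.Build
  R[i] (sphere -> R[i]) polynomial_pred polynomial_submod.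

Record testfun := Test {
  test_fun :> sphere -> R[i];
  _ : test_fun \in polynomial_pred
}.

HB.instance Definition _ := [isSub for test_fun].
HB.instance Definition _ := [Choice of testfun by <:].
HB.instance Definition _ := [SubChoice_isSubLmodule of testfun by <:].

Definition test_of f (hf : polynomial_fun f) : testfun := Test (asboolT hf).

Fact test_coordP j (f : testfun) : polynomial_fun (xcoord j * test_fun f).
Proof.
apply: polynomial_mul; first exact: polynomial_coord.
by case: f => f /= /asboolP.
Qed.

Definition test_coord j (f : testfun) : testfun := test_of (test_coordP j f).

Fact cisD a b : cis (a + b) = cis a * cis b.
Proof. by rewrite /cis cosD sinD; apply/eqP; rewrite eq_complex /= !eqxx /= addrC. Qed.

Fact cisM n a : cis (n%:R * a) = cis a ^+ n.
Proof.
elim: n => [|n IH]; first by rewrite mul0r expr0 /cis cos0 sin0.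
by rewrite exprS -IH -natr1 mulrDl mul1r addrC cisD.
Qed.

Fact polynomial_exp f n : polynomial_fun f -> polynomial_fun (f ^+ n).
Proof.
move=> hf; elim: n => [|n IH]; first exact: (polynomial_cst 1).
by rewrite exprS; exact: polynomial_mul.
Qed.

Fact polynomial_horner (q : {poly R}) j :
  polynomial_fun (fun x => (q.[val x 0 j])%:C).
Proof.
elim/poly_ind: q => [|q c IH].
  rewrite (_ : (fun x => _) = cst 0); first exact: polynomial_cst.
  by apply/funext => x; rewrite horner0.
pose g : sphere -> R[i] := fun x => (q.[val x 0 j])%:C.
rewrite (_ : (fun x => _) = g * xcoord j + cst c%:C).
  apply: polynomial_add (polynomial_cst _).
  by apply: polynomial_mul => //; exact: polynomial_coord.
apply/funext => x; rewrite hornerMXaddC.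
by rewrite rmorphD rmorphM.
Qed.

Fact Ylm_conj_polynomial l m : polynomial_fun (fun x => conjc (Ylm l m x)).
Proof.
set k := `|m|%N.
pose e : R[i] := (if (0 <= m)%R then - 'i else 'i)%C.
pose c : R[i] := (harmonic_norm l k * (-1) ^+ k)%:C.
rewrite (_ : (fun x => _) = cst c *
  (xcoord 0 + cst e * xcoord 1) ^+ k *
  (fun x => ((legendre l)^`(k).[val x 0 2%:R])%:C)).
  apply: polynomial_mul; last exact: polynomial_horner.
  apply: polynomial_mul; first exact: polynomial_cst.
  apply: polynomial_exp; apply: polynomial_add (polynomial_coord _) _.
  by apply: polynomial_mul (polynomial_cst _) (polynomial_coord _).
apply/funext => x; rewrite /Ylm.
have := anglesK x; case: (angles x) => th ph xE.
have expE (f : sphere -> R[i]) n y : (f ^+ n) y = f y ^+ n.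
  by elim: n => [|n IH] //; rewrite !exprS -IH.
rewrite -[RHS]/(c * ((xcoord 0 + cst e * xcoord 1) ^+ k) x *
  ((legendre l)^`(k).[val x 0 2%:R])%:C) expE.
rewrite -[(xcoord 0 + _) x]/(xcoord 0 x + e * xcoord 1 x) /xcoord -xE !mxE.
rewrite -[_`_0]/(cos ph * sin th) -[_`_1]/(sin ph * sin th) -[_`_2]/(cos th).
have conjM (a b : R) (z : R[i]) : conjc (a%:C * z * b%:C) = a%:C * conjc z * b%:C.
  by case: z => z1 z2; apply/eqP; rewrite eq_complex /=;
    apply/andP; split; apply/eqP; ring.
have realM (a b : R) : (a * b)%:C = a%:C * b%:C by exact: rmorphM.
have realX (a : R) n : (a ^+ n)%:C = a%:C ^+ n by exact: rmorphXn.
rewrite conjM /assoc_legendre -/k.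
pose w : R[i] := cos ph +i* (if 0 <= m then - sin ph else sin ph).
have -> : conjc (cis (m%:~R * ph)) = w ^+ k.
  have conj_cis a : conjc (cis a) = cis (- a) by rewrite /cis cosN sinN.
  rewrite conj_cis /w /k; case: (m) => n /=.
    by rewrite -mulrN cisM /cis cosN sinN.
  by rewrite NegzE mulrNz mulNr opprK -pmulrn cisM.
have -> : (cos ph * sin th)%:C + e * (sin ph * sin th)%:C = w * (sin th)%:C.
  by rewrite /e /w; case: ifP => _; apply/eqP; rewrite eq_complex /=;
    apply/andP; split; apply/eqP; ring.
by rewrite exprMn /c !realM !realX; ring.
Qed.

(* [Ylm l m] conjugated, as a test function *)
Definition Ylm_conj l m : testfun := test_of (Ylm_conj_polynomial l m).

(* Linearity is only imposed in [sobolev_pred]. *)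
Definition gfun := testfun -> R[i].

Definition gmul (j : 'I_3) (u : gfun) : gfun := fun f => u (test_coord j f).

Definition angle_measure : set angle_space -> \bar R :=
  (lebesgue_measure \x lebesgue_measure)%E.
HB.instance Definition _ := Measure.on angle_measure.

Definition sphere_Rintegral (f : sphere -> R) : R :=
  (\int[angle_measure]_(t in angle_box) (f (of_angles t) * sin t.1))%R.

Definition sphere_integral (f : sphere -> R[i]) : R[i] :=
  sphere_Rintegral (fun x => complex.Re (f x)) +i*
  sphere_Rintegral (fun x => complex.Im (f x)).

Definition sqnormc (z : R[i]) : R := complex.Re z ^+ 2 + complex.Im z ^+ 2.

(* Square integrable (not quotiented by almost everywhere equality) *)
Definition L2 (f : sphere -> R[i]) : Prop :=
  [/\ measurable_fun angle_box (fun t => complex.Re (f (of_angles t))),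
      measurable_fun angle_box (fun t => complex.Im (f (of_angles t)))
    & (\int[angle_measure]_(t in angle_box)
         (sqnormc (f (of_angles t)) * sin t.1)%:E < +oo)%E].

(* The canonical (bilinear) embedding of functions into generalized functions: *)
(* on L^2 it is injective up to almost everywhere equality.                    *)
Definition gfun_of (f : sphere -> R[i]) : gfun :=
  fun g => sphere_integral (f * test_fun g).

(* For [u = gfun_of f] this is the coefficient <f, Ylm l m> of [f]. *)
Definition coef (u : gfun) (l : nat) (m : int) : R[i] := u (Ylm_conj l m).

(* [sum_(-l <= m <= l) |coef u l m|^2] *)
Definition degree_energy (u : gfun) (l : nat) : R :=
  \sum_(k < (2 * l).+1) sqnormc (coef u l (k%:Z - l%:Z)).

(* The squared norm [ || (1 - Laplace-Beltrami)^(s/2) u ||^2 ] *)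
Definition sobolev_energy (s : R) (u : gfun) : \bar R :=
  (\sum_(0 <= l <oo) ((1 + l%:R * (l%:R + 1)) `^ s * degree_energy u l)%:E)%E.

(* Polynomials on the sphere are the span of the spherical harmonics, so that  *)
(* linear functionals on them are the formal series of spherical harmonics.    *)
(* For every real order [s], this realizes H^s as the completion of that span  *)
(* for the norm given by [sobolev_energy s]; negative orders are allowed.      *)
Definition sobolev_pred (s : R) : {pred gfun} :=
  fun u => `[< scalar u /\ (sobolev_energy s u < +oo)%E >].

Fact sqnormc_ge0 z : 0 <= sqnormc z.
Proof. by rewrite addr_ge0 ?sqr_ge0. Qed.

Fact sqnormc_comb a z w :
  sqnormc (a * z + w) <= 2 * sqnormc a * sqnormc z + 2 * sqnormc w.
Proof.
case: a z w => [a b] [x y] [u v]; rewrite /sqnormc /=; rewrite -subr_ge0.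
apply: (@le_trans _ _ ((a * x - b * y - u) ^+ 2 + (a * y + b * x - v) ^+ 2)).
  by rewrite addr_ge0 ?sqr_ge0.
by rewrite le_eqVlt; apply/orP; left; apply/eqP; ring.
Qed.

Fact degree_energy_ge0 u l : 0 <= degree_energy u l.
Proof. by apply: sumr_ge0 => k _; exact: sqnormc_ge0. Qed.

Fact degree_energy_comb a u v l :
  degree_energy (a *: u + v) l <=
  2 * sqnormc a * degree_energy u l + 2 * degree_energy v l.
Proof.
rewrite /degree_energy !mulr_sumr -big_split /=; apply: ler_sum => k _.
exact: sqnormc_comb.
Qed.

Fact sobolev_submod s : submod_closed (sobolev_pred s).
Proof.
split=> [|a u v /asboolP[ul us] /asboolP[vl vs]]; apply/asboolP; split.
- by move=> c f g; change (0 = c * 0 + 0 :> R[i]); rewrite mulr0 addr0.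
- rewrite /sobolev_energy eseries0 ?ltry // => l _ _.
  rewrite /degree_energy big1 ?mulr0 // => k _.
  by rewrite /sqnormc /= expr0n addr0.
- move=> c f g; rewrite -![(_ + v) _]/(a * u _ + v _) ul vl; ring.
have w0 l : 0 <= (1 + l%:R * (l%:R + 1)) `^ s :> R by exact: powR_ge0.
have t0 w l : (0 <= ((1 + l%:R * (l%:R + 1)) `^ s * degree_energy w l)%:E)%E.
  by rewrite lee_fin mulr_ge0 // degree_energy_ge0.
apply: (@le_lt_trans _ _ ((2 * sqnormc a)%:E * sobolev_energy s u
   + 2%:E * sobolev_energy s v)%E); last first.
  by apply: lte_add_pinfty; apply: lte_mul_pinfty => //;
    rewrite ?lee_fin ?mulr_ge0 ?sqnormc_ge0.
rewrite /sobolev_energy -!nneseriesZl //.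
rewrite -nneseriesD; last 2 first.
- by move=> l _ _; rewrite mule_ge0 // lee_fin mulr_ge0 ?sqnormc_ge0.
- by move=> l _ _; rewrite mule_ge0 // lee_fin.
apply: lee_nneseries => [l _ _|l _]; first exact: t0.
rewrite -!EFinM -EFinD lee_fin.
apply: le_trans (ler_wpM2l (w0 l) (degree_energy_comb a u v l)) _.
by rewrite le_eqVlt; apply/orP; left; apply/eqP; ring.
Qed.

HB.instance Definition _ s := GRing.isSubmodClosed.Build
  R[i] gfun (sobolev_pred s) (sobolev_submod s).

(* The Sobolev space H^s of the sphere *)
Record sobolev (s : R) := Sobolev {
  sobolev_gfun :> gfun;
  _ : sobolev_gfun \in sobolev_pred s
}.

HB.instance Definition _ s := [isSub for @sobolev_gfun s].
HB.instance Definition _ s := [Choice of sobolev s by <:].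
HB.instance Definition _ s := [SubChoice_isSubLmodule of sobolev s by <:].

Definition sobolev_norm s (u : sobolev s) : R :=
  Num.sqrt (fine (sobolev_energy s (val u))).

Definition sobolev_continuous p r (S : sobolev p -> sobolev r) : Prop :=
  forall u (eps : R), 0 < eps -> exists2 delta : R, 0 < delta &
    forall v, sobolev_norm (v - u) < delta -> sobolev_norm (S v - S u) < eps.

(* [S_normal S psi chi]: [S_n] is defined at [psi] in L^2 with value [chi] in  *)
(* L^2.  For [p <= 0 <= r] every [psi] in L^2 is in the domain of [S_n]; for    *)
(* other orders the formula defines [S_n] where it makes sense.                *)
Definition S_normal p r (S : sobolev p -> sobolev r)
    (psi chi : sphere -> R[i]) : Prop :=
  [/\ L2 psi, L2 chi &
      exists2 u : 'I_3 -> sobolev p,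
        forall j, val (u j) = gfun_of (xcoord j * psi) &
        gfun_of chi = \sum_j gmul j (val (S (u j)))].

End Sphere.

Definition normal_eigenvalue (K : fieldType) (s : nat -> K) (l : nat) : K :=
  if l is 0%N then s 1%N
  else l%:R / (2 * l + 1)%:R * s l.-1 + l.+1%:R / (2 * l + 1)%:R * s l.+1.

(* Main.v *)
(* Write e = +-i, z = x1 + e x2 and W_l^k = z^k P_l^(k)(x3), with P_l^(k) the k-th
   derivative of the Legendre polynomial, so that Y_l^m is a multiple of W_l^|m|.
   The classical recurrences for P_l^(k) express x3 W_l^k, z W_l^k and
   (x1 - e x2) W_l^k through functions W of degrees l - 1 and l + 1 only.  Hence
   x_j Y_l^m = A_j + B_j with A_j (resp. B_j) in the span of the harmonics of degree
   l - 1 (resp. l + 1), and S acts on x_j Y_l^m as s_(l-1) on A_j and s_(l+1) on B_j.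
   The Legendre equation gives sum_j x_j A_j = l / (2l + 1) Y_l^m, and since
   sum_j x_j^2 = 1 also sum_j x_j B_j = (l + 1) / (2l + 1) Y_l^m.
   That x_j Y_l^m lies in H^p for every p is the orthogonality of harmonics of
   different degrees, which makes its energy a finite sum. *)
Require Import Defs.
From mathcomp Require Import all_boot all_order all_algebra.
From mathcomp Require Import all_classical all_reals all_analysis.
From mathcomp Require Import complex.
From mathcomp Require Import measurable_realfun ring lra zify.

Import Order.TTheory GRing.Theory Num.Theory.
Import numFieldNormedType.Exports.

Local Open Scope ring_scope.

Set Implicit Arguments.
Unset Strict Implicit.

(* Proves [a = b] from [e = f] by a ring identity; iterating it adds up a linear
   combination of several equations. *)
Lemma eq_lin (V : zmodType) (a b e f : V) : e = f -> a - b = e - f -> a = b.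
Proof. by move=> -> /eqP; rewrite subrr subr_eq0 => /eqP. Qed.

(** * Legendre polynomials *)

Section Legendre.
Variable R : realType.
Implicit Types p q v : {poly R}.
Local Notation P := (@legendre R).
Local Notation U n := (('X^2 - 1 : {poly R}) ^+ n).

Lemma derivnMX p k : (p * 'X)^`(k) = p^`(k) * 'X + p^`(k.-1) *+ k.
Proof.
case: k => [|k]; first by rewrite !derivn0 mulr0n addr0.
by have := derivnMXaddC k p 0; rewrite addr0 => ->; rewrite addrC.
Qed.

Lemma derivn_predMn p k : p^`(k.-1.+1) *+ k = p^`(k) *+ k.
Proof. by case: k. Qed.

Let dU n : (U n.+1)^`() = U n * 'X *+ (2 * n.+1).
Proof.
by rewrite deriv_exp derivB derivXn derivC subr0 /= expr1 mulrnAl -mulrnA mulrC.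
Qed.

(** The first-order equation [(X^2 - 1) U' = 2 n X U] for [U = (X^2 - 1)^n]. Its [n]-th derivative
    is the source of the Legendre equation. *)
Let dU2 n : (U n)^`() * 'X * 'X - (U n)^`() = U n * 'X *+ (2 * n).
Proof.
case: n => [|n]; first by rewrite expr0 derivC !mul0r subr0 muln0.
rewrite dU [U n.+1]exprS !mulrnAl -mulrnBl; congr (_ *+ _).
by rewrite expr2; move: (U n) 'X => u x; ring.
Qed.

Let c n : R := (2 ^+ n * n`!%:R)^-1.

Let c_rec n : c n.+1 * (2 * n.+1)%:R = c n.
Proof.
rewrite /c factS exprS.
have -> : 2 * 2 ^+ n * (n.+1 * n`!)%:R = (2 * n.+1)%:R * (2 ^+ n * n`!%:R) :> R.
  by rewrite !natrM mulrACA.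
by rewrite invfM mulrAC mulVf ?mul1r // pnatr_eq0.
Qed.

(** For [n > 0] a primitive of [P n]. At [n = 0] it is the constant 1, and it only ever occurs with
    a factor [n]. *)
Let Q n : {poly R} := c n *: (U n)^`(n.-1).

(** Of the [n.+1] derivatives in Rodrigues' formula, the first produces [2 (n + 1) X (X^2 - 1)^n];
    the Leibniz rule handles the other [n]. *)
Let legendre_rec0 n : P n.+1 = P n * 'X + Q n *+ n.
Proof.
rewrite /legendre /Q -/(c n.+1) derivSn dU derivnMn derivnMX.
rewrite -scaler_nat scalerA c_rec scalerDr -scalerAl -/(c n); congr (_ + _).
by rewrite scalerMnr.
Qed.

Lemma legendre_deriv n : (P n.+1)^`() = (P n)^`() * 'X + P n *+ n.+1.
Proof.
rewrite legendre_rec0 derivD derivM derivX mulr1 derivMn -addrA; congr (_ + _).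
suff -> : (Q n)^`() *+ n = P n *+ n by rewrite mulrS.
by case: n => [|n] //; rewrite /Q derivZ -derivnS.
Qed.

(** The Legendre equation integrated once: since [Q n] is a primitive of [P n], its derivative reads
    [((X^2 - 1) P_n')' = n (n + 1) P_n]. *)
Let legendre_Q n : (P n)^`() * 'X * 'X - (P n)^`() = Q n *+ (n * n.+1).
Proof.
case: n => [|n].
  by rewrite mul0n mulr0n /legendre expr0 !derivZ !derivC scaler0 !mul0r subr0.
have := congr1 (fun p => p^`(n.+1)) (dU2 n.+1).
have dS p k : p^`()^`(k) = p^`(k.+1) by rewrite derivSn.
have V0 : (U n.+1)^`()^`(n.-1) *+ n = (U n.+1)^`(n) *+ n.
  by case: (n) => // k; rewrite dS.
rewrite derivnB derivnMn !derivnMX mulrnDl -!pred_Sn V0 !dS => E.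
have {E} : (U n.+1)^`(n.+2) * 'X * 'X - (U n.+1)^`(n.+2) =
    (U n.+1)^`(n) *+ (n.+1 * n.+2).
  move: E; set a := (U n.+1)^`(n.+2); set b := (U n.+1)^`(n.+1).
  set d := (U n.+1)^`(n); move: a b d 'X => a b d x E.
  by apply: subr0_eq; move/eqP: E; rewrite -subr_eq0 => /eqP E; rewrite -[RHS]E; ring.
move=> /(congr1 (fun p => c n.+1 *: p)).
by rewrite scalerBr -scalerMnr !scalerAl /legendre derivZ -derivnS.
Qed.

(** [Q n] is eliminated between [legendre_rec0] and [legendre_Q]. *)
Lemma legendre_christoffel n :
  (P n)^`() * ('X * 'X - 1) = P n.+1 *+ n.+1 - P n * 'X *+ n.+1.
Proof.
rewrite legendre_rec0 mulrBr mulr1 mulrA legendre_Q mulrnA mulrnDl addrAC subrr.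
by rewrite add0r.
Qed.

Lemma legendre_derivX n : (P n)^`() * 'X = (P n.-1)^`() + P n *+ n.
Proof.
case: n => [|n].
  by rewrite mulr0n addr0 /legendre /= expr0 derivZ derivC scaler0 mul0r.
have E := legendre_christoffel n; rewrite legendre_deriv /=.
by apply: (eq_lin E); ring.
Qed.

(** The terms [X P_n'] cancel in the difference of [legendre_deriv] and [legendre_derivX], which is
    then differentiated [k] times. *)
Lemma legendre_derivnD n k : (P n)^`(k) * (2 * n).+1%:R =
  (P n.+1)^`(k.+1) - (P n.-1)^`(k.+1).
Proof.
rewrite mulr_natr !derivSn -derivnB -derivnMn; congr (_^`(k)).
rewrite legendre_deriv legendre_derivX; ring.
Qed.

Lemma legendre_derivnX n k : (P n)^`(k.+1) * 'X =
  (P n.-1)^`(k.+1) + (P n)^`(k) * (n%:R - k%:R).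
Proof.
have := congr1 (fun p => p^`(k)) (legendre_derivX n).
rewrite derivnMX derivnD derivnMn -!derivSn.
rewrite derivn_predMn.
by move=> /(canRL (addrK _)) ->; ring.
Qed.

Lemma legendre_derivnS n k : (P n.+1)^`(k.+1) =
  (P n)^`(k.+1) * 'X + (P n)^`(k) * (n.+1%:R + k%:R).
Proof.
have := congr1 (fun p => p^`(k)) (legendre_deriv n).
rewrite derivnD derivnMX derivnMn -!derivSn.
rewrite derivn_predMn.
by move=> ->; ring.
Qed.

Lemma legendre0 : P 0 = 1.
Proof. by rewrite /legendre expr0 derivn0 fact0 mulr1 invr1 scale1r. Qed.

Lemma derivn_legendre0 k : (P 0)^`(k.+1) = 0.
Proof. by rewrite legendre0 derivnC. Qed.

(* The recurrences below also hold at [n = 0], where [n.-1 = 0]: the coefficient or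
   the derivative of the spurious term vanishes. *)
Lemma legendre_three_term n k : (P n)^`(k) * 'X * (2 * n).+1%:R =
  (P n.+1)^`(k) * (n.+1%:R - k%:R) + (P n.-1)^`(k) * (n%:R + k%:R).
Proof.
(* Bonnet's recurrence. Differentiating it [k] times leaves a Leibniz term in the derivative of
   order [k - 1], which [legendre_derivnD] converts back to degrees [n - 1] and [n + 1]. *)
have base m : P m * 'X * (2 * m).+1%:R = P m.+1 * m.+1%:R + P m.-1 * m%:R.
  case: m => [|m]; first by rewrite legendre_rec0 muln0 mulr0n mulr0 !addr0.
  have E3 := legendre_christoffel m.+1.
  have /= E2 := legendre_derivX m.+1; have E1 := legendre_deriv m.
  apply: (eq_lin E3); apply: (eq_lin (congr1 (fun p => p * 'X) (esym E2))).
  by apply: (eq_lin E1); ring.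
have := congr1 (fun p => p^`(k)) (base n).
rewrite !mulr_natr derivnD !derivnMn derivnMX.
case: k => [|k].
  by move=> E; apply: (eq_lin E); ring.
move=> E2; have E1 := legendre_derivnD n k.
apply: (eq_lin E2); apply: (eq_lin (congr1 (fun p => p * k.+1%:R) (esym E1))).
by ring.
Qed.

(** For [n > 0], [(1 - X^2) P_n^(k+1) = (n + k) P_(n-1)^(k) - (n - k) X P_n^(k)]; the three-term
    recurrence then removes the factor [X]. *)
Lemma legendre_lower n k : (P n)^`(k.+1) * (1 - 'X * 'X) * (2 * n).+1%:R =
  (P n.-1)^`(k) * ((n%:R + k.+1%:R) * (n%:R + k%:R))
  - (P n.+1)^`(k) * ((n%:R - k%:R) * (n.+1%:R - k%:R)).
Proof.
case: n => [|n].
  have P1 : P 1 = 'X by rewrite legendre_rec0 legendre0 mul1r addr0.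
  rewrite derivn_legendre0 !mul0r /= P1; case: k => [|k].
    by rewrite legendre0 /=; ring.
  rewrite derivn_legendre0 derivSn derivX -legendre0.
  by case: k => [|k]; rewrite ?derivn_legendre0 /=; ring.
have E1 : (P n.+1)^`(k.+1) * (1 - 'X * 'X) =
   (P n)^`(k) * (n.+1%:R + k%:R) - (P n.+1)^`(k) * 'X * (n.+1%:R - k%:R).
  have /= E2 := legendre_derivnX n.+1 k; have E3 := legendre_derivnS n k.
  by apply: (eq_lin E3); apply: (eq_lin (congr1 (fun p => - (p * 'X)) E2)); ring.
have E2 := legendre_three_term n.+1 k.
apply: (eq_lin (congr1 (fun p => p * (2 * n.+1).+1%:R) E1)).
apply: (eq_lin (congr1 (fun p => - (p * (n.+1%:R - k%:R))) E2)).
by ring.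
Qed.

(** The [k]-th derivative of the Legendre equation, obtained by eliminating [P n.-1] from three
    instances of the recurrences. *)
Lemma legendre_ode n k : (P n)^`(k.+2) * (1 - 'X * 'X) =
  (P n)^`(k.+1) * 'X * (k.+1%:R * 2) -
  (P n)^`(k) * (n%:R * n.+1%:R - k%:R * k.+1%:R).
Proof.
have := legendre_derivnX n k.+1; have := legendre_derivnS n.-1 k.+1.
have := legendre_derivnX n k.
case: n => [|n].
  move=> _ _ _; rewrite !derivn_legendre0 !mul0r sub0r.
  by case: k => [|k]; rewrite ?derivn_legendre0 ?mul0r ?subrr ?mulr0 oppr0.
rewrite -![n.+1.-1]/n => E1 E2 E3.
apply: (eq_lin E2); apply: (eq_lin (congr1 (fun p => - (p * 'X)) E3)).
by apply: (eq_lin (congr1 (fun p => - (p * (n + k).+2%:R)) E1)); ring.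
Qed.

(** Evaluates [sum_j x_j A_j] for harmonics of order 0: the right-hand side collects the
    contributions of degree [n - 1]. *)
Lemma legendre_christoffel_pred n :
  P n * n%:R = P n.-1 * 'X * n%:R - (P n.-1)^`() * (1 - 'X * 'X).
Proof.
case: n => [|n].
  by rewrite -derivn1 derivn_legendre0; ring.
by apply: (eq_lin (esym (legendre_christoffel n))); ring.
Qed.

(** The analogue of [legendre_christoffel_pred] in positive order [k + 1]. The three terms on the
    right come from the coordinate [x3], from lowering and from raising the order; they combine
    through the Legendre equation in degree [n - 1]. *)
Lemma legendre_christoffel_derivn n k : (P n)^`(k.+1) * (n%:R * 2) =
  (P n.-1)^`(k.+1) * 'X * ((n%:R + k.+1%:R) * 2)
  + (P n.-1)^`(k) * ((n%:R + k.+1%:R) * (n%:R + k%:R))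
  - (P n.-1)^`(k.+2) * (1 - 'X * 'X).
Proof.
case: n => [|n].
  rewrite !derivn_legendre0 !mul0r add0r subr0.
  by case: k => [|k]; rewrite ?derivn_legendre0; ring.
apply: (eq_lin (congr1 (fun p => p * (n.+1%:R * 2)) (legendre_derivnS n k))).
by apply: (eq_lin (legendre_ode n k)); ring.
Qed.

(** * Degree bounds for Legendre polynomials and their derivatives *)

Lemma size_rodrigues n : (size (U n) <= (2 * n).+1)%N.
Proof.
apply: leq_trans (size_poly_exp_leq _ _) _.
by rewrite -polyC1 size_XnsubC.
Qed.

Lemma derivn_legendre n k : (P n)^`(k) = c n *: (U n)^`(n + k).
Proof. by rewrite /legendre derivnZ addnC [in RHS]/derivn iterD. Qed.

Lemma derivn_legendre_eq0 n k : (n < k)%N -> (P n)^`(k) = 0.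
Proof.
move=> nk; rewrite derivn_legendre derivn_poly0 ?scaler0 //.
by apply: leq_trans (size_rodrigues n) _; rewrite mul2n -addnn ltn_add2l.
Qed.

End Legendre.

(** * Spherical harmonics as polynomials in the coordinates *)

Section SolidHarmonics.
Variable R : realType.
Local Notation C := R[i].
Local Notation P := (@legendre R).
Implicit Types (x : sphere R) (s : bool) (l k : nat).

(** The boolean [s] is the sign bit of the order: [s = (m < 0)] selects [i] or [-i]. *)
Definition imag_unit s : C := (-1) ^+ s * 'i%C.

(* [sin theta * exp (+- i phi)], with [+] for [s = false]. *)
Definition azimuthal s x : C := xcoord 0 x + imag_unit s * xcoord 1 x.

(** The function [W_l^k], free of any choice of angles. Without the normalization its recurrences
    have rational coefficients, and it makes sense, as the zero function, for [k > l]. *)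
Definition solid s l k x : C :=
  azimuthal s x ^+ k * (((P l)^`(k)).[val x 0 2%:R])%:C%C.

Lemma imag_unit2 s : imag_unit s * imag_unit s = -1.
Proof.
have h : 'i%C * 'i%C = -1 :> C by rewrite -expr2 sqr_i.
by rewrite /imag_unit mulrACA h -expr2 sqrr_sign mul1r.
Qed.

Lemma imag_unitN s : imag_unit (~~ s) = - imag_unit s.
Proof. by case: s; rewrite /imag_unit /= ?expr0 ?expr1 ?mulN1r ?mul1r ?opprK. Qed.

Lemma sum_xcoord2 x : \sum_j xcoord j x * xcoord j x = 1.
Proof.
have := valP x => /eqP /(congr1 (fun r : R => r%:C%C)); rewrite /= rmorph_sum /= rmorph1 => <-.
by apply: eq_bigr => j _; rewrite expr2 rmorphM.
Qed.

(** Both sides are [x1^2 + x2^2]. This turns the factor [1 - X^2] of the Legendre recurrences into a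
    product of azimuthal factors. *)
Lemma azimuthalM s x :
  azimuthal s x * azimuthal (~~ s) x = 1 - xcoord 2%:R x * xcoord 2%:R x.
Proof.
have := sum_xcoord2 x; rewrite !big_ord_recl big_ord0 addr0 => <-.
have -> : lift ord0 ord0 = 1 :> 'I_3 by apply: val_inj.
have -> : lift ord0 (lift ord0 ord0) = 2%:R :> 'I_3 by apply: val_inj.
have i2 := imag_unit2 s; rewrite /azimuthal imag_unitN.
by transitivity (xcoord 0 x * xcoord 0 x - imag_unit s * imag_unit s * (xcoord 1 x * xcoord 1 x));
  [ring | rewrite i2; ring].
Qed.

Lemma harmonic_norm_gt0 l k : 0 < harmonic_norm R l k.
Proof.
rewrite sqrtr_gt0; apply: mulr_gt0; apply: divr_gt0; rewrite ?ltr0n ?fact_gt0 //.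
by rewrite mulr_gt0 // pi_gt0.
Qed.

Definition harmonic_coef l k : C := (harmonic_norm R l k * (-1) ^+ k)%:C%C.

Lemma harmonic_coef_neq0 l k : harmonic_coef l k != 0.
Proof.
rewrite /harmonic_coef rmorphM /= mulf_neq0 //.
  by rewrite -(rmorph0 (@real_complex R)) (inj_eq (@complexI R)) gt_eqF // harmonic_norm_gt0.
by rewrite rmorphXn rmorphN rmorph1 /= signr_eq0.
Qed.

Lemma azimuthal_angles s (t : R * R) :
  azimuthal s (of_angles t) = cis ((-1) ^+ s * t.2) * (sin t.1)%:C%C.
Proof.
rewrite /azimuthal /imag_unit /xcoord !mxE.
rewrite -[_`_0]/(cos t.2 * sin t.1) -[_`_1]/(sin t.2 * sin t.1) /cis.
by case: s; rewrite ?expr1 ?expr0 ?mulN1r ?mul1r ?cosN ?sinN; apply/eqP;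
  rewrite eq_complex /=; apply/andP; split; apply/eqP; ring.
Qed.

Lemma solid_angles s l k (t : R * R) : solid s l k (of_angles t) =
  cis ((-1) ^+ s * (k%:R * t.2)) * (sin t.1 ^+ k * ((P l)^`(k)).[cos t.1])%:C%C.
Proof.
rewrite /solid azimuthal_angles exprMn mxE -[_`_2]/(cos t.1).
by rewrite [_ * (k%:R * _)]mulrCA cisM rmorphM rmorphXn mulrA.
Qed.

(** Only [anglesK] is used about [angles], so the arbitrary azimuth at the poles does no harm. *)
Lemma Ylm_solid l m :
  Ylm l m = harmonic_coef l `|m| *: solid (m < 0) l `|m| :> (sphere R -> C).
Proof.
apply/funext => x; rewrite -[RHS]/(_ * _) /Ylm -{2}(anglesK x).
case: (angles x) => th ph; rewrite solid_angles /assoc_legendre /harmonic_coef /=.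
have -> : m%:~R * ph = (-1) ^+ (m < 0)%R * (`|m|%:R * ph).
  case: m => n /=; first by rewrite expr0 mul1r.
  by rewrite expr1 mulN1r NegzE mulrNz mulNr.
rewrite !rmorphM /=; ring.
Qed.

(** The inductive form gives the induction by which splitting, polynomiality, Sobolev membership and
    the action of [S] pass from the harmonics to their combinations. *)
Inductive harmonic_span l : (sphere R -> C) -> Prop :=
| harmonic_span0 : harmonic_span l 0
| harmonic_span_Ylm m : (`|m| <= l)%N -> harmonic_span l (Ylm l m)
| harmonic_spanD f g : harmonic_span l f -> harmonic_span l g -> harmonic_span l (f + g)
| harmonic_spanZ c f : harmonic_span l f -> harmonic_span l (c *: f).

Lemma harmonic_span_solid s l k : harmonic_span l (solid s l k).
Proof.
have [kl|lk] := leqP k l; last first.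
  suff -> : solid s l k = 0 by exact: harmonic_span0.
  by apply/funext => x; rewrite /solid derivn_legendre_eq0 // horner0 mulr0.
pose m : int := (-1) ^+ s * k%:Z.
have mk : `|m|%N = k by rewrite abszMsign absz_nat.
have -> : solid s l k = (harmonic_coef l k)^-1 *: Ylm l m.
  rewrite Ylm_solid mk scalerA mulVf ?harmonic_coef_neq0 // scale1r.
  (* For [k = 0] the sign [s] cannot be read off [m], but [solid] does not depend on it then. *)
  rewrite /m; case: s k {kl m mk} => -[|k] //.
by apply: harmonic_spanZ; apply: harmonic_span_Ylm; rewrite mk.
Qed.

(** * Multiplication of harmonics by the coordinates *)

Lemma solid_x3 s l k x : xcoord 2%:R x * solid s l k x * (2 * l).+1%:R =
  (l.+1%:R - k%:R) * solid s l.+1 k x + (l%:R + k%:R) * solid s l.-1 k x.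
Proof.
have := congr1 (fun p => (p.[val x 0 2%:R])%:C%C) (legendre_three_term R l k).
rewrite /= -!polyC_natr !(hornerMX, hornerD, hornerM, hornerN, hornerC).
rewrite !(rmorphD, rmorphM, rmorphN, rmorph_nat) /=.
rewrite -[(val x 0 2%:R)%:C%C]/(xcoord 2%:R x) => E.
by apply: (eq_lin (congr1 (fun c => azimuthal s x ^+ k * c) E)); rewrite /solid; ring.
Qed.

Lemma solid_raise s l k x : azimuthal s x * solid s l k x * (2 * l).+1%:R =
  solid s l.+1 k.+1 x - solid s l.-1 k.+1 x.
Proof.
have := congr1 (fun p => (p.[val x 0 2%:R])%:C%C) (legendre_derivnD R l k).
rewrite /= -!polyC_natr !(hornerMX, hornerD, hornerM, hornerN, hornerC).
rewrite !(rmorphD, rmorphM, rmorphN, rmorph_nat) /= => E.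
by apply: (eq_lin (congr1 (fun c => azimuthal s x ^+ k.+1 * c) E)); rewrite /solid exprS; ring.
Qed.

(** One azimuthal factor of [solid s l k.+1] meets the opposite one; their product [1 - x3^2] is the
    factor in [legendre_lower]. *)
Lemma solid_lower s l k x :
  azimuthal (~~ s) x * solid s l k.+1 x * (2 * l).+1%:R =
  (l%:R + k.+1%:R) * (l%:R + k%:R) * solid s l.-1 k x
  - (l%:R - k%:R) * (l.+1%:R - k%:R) * solid s l.+1 k x.
Proof.
have := congr1 (fun p => (p.[val x 0 2%:R])%:C%C) (legendre_lower R l k).
rewrite /= -!polyC_natr -polyC1 !(hornerMX, hornerX, hornerD, hornerM, hornerN, hornerC).
rewrite !(rmorphD, rmorphM, rmorphN, rmorph_nat, rmorph1) /=.
rewrite -[(val x 0 2%:R)%:C%C]/(xcoord 2%:R x) -(azimuthalM s) => E.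
by apply: (eq_lin (congr1 (fun c => azimuthal s x ^+ k * c) E)); rewrite /solid exprS; ring.
Qed.

Lemma solid0N s l : solid (~~ s) l 0 = solid s l 0.
Proof. by apply/funext => x; rewrite /solid !expr0. Qed.


(** Only [sum_j x_j A_j] is recorded, since [sum_j x_j^2 = 1] then determines [sum_j x_j B_j]. At
    [l = 0], where [l.-1 = 0], the last condition says that the [A] part contributes nothing. *)
Definition degree_split l (f : sphere R -> C) :=
  exists A B : 'I_3 -> sphere R -> C,
  [/\ forall j, harmonic_span l.-1 (A j), forall j, harmonic_span l.+1 (B j),
      forall j, xcoord j * f = A j + B j &
      \sum_j xcoord j * A j = (l%:R / (2 * l).+1%:R) *: f].

(** A change of basis: the recurrences concern [z = x1 + e x2] and [z' = x1 - e x2], while the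
    splitting concerns [x1] and [x2]. Under it [x1 A_1 + x2 A_2] becomes [(z Am + z' Ap) / 2]. *)
Lemma degree_split_azimuthal s l (f Ap Am A3 Bp Bm B3 : sphere R -> C) :
  harmonic_span l.-1 Ap -> harmonic_span l.-1 Am -> harmonic_span l.-1 A3 ->
  harmonic_span l.+1 Bp -> harmonic_span l.+1 Bm -> harmonic_span l.+1 B3 ->
  (forall x, azimuthal s x * f x = Ap x + Bp x) ->
  (forall x, azimuthal (~~ s) x * f x = Am x + Bm x) ->
  (forall x, xcoord 2%:R x * f x = A3 x + B3 x) ->
  (forall x, azimuthal s x * Am x + azimuthal (~~ s) x * Ap x
     + 2 * (xcoord 2%:R x * A3 x) = 2 * (l%:R / (2 * l).+1%:R * f x)) ->
  degree_split l f.
Proof.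
move=> hAp hAm hA3 hBp hBm hB3 Ep Em E3 Ec.
(* As [e^2 = -1], the inverse change of basis is [x1 = (z + z') / 2], [x2 = - e (z - z') / 2]. *)
pose mix (p m t : sphere R -> C) (j : 'I_3) : sphere R -> C :=
  [:: 2^-1 *: (p + m); (- imag_unit s / 2) *: (p + (-1) *: m); t]`_j.
have two0 : 2 != 0 :> C by rewrite pnatr_eq0.
have i2 := imag_unit2 s; have iN := imag_unitN s.
have mixP n p m t j : harmonic_span n p -> harmonic_span n m -> harmonic_span n t ->
    harmonic_span n (mix p m t j).
  move=> hp hm ht; case: j => -[|[|[|//]]] hj; rewrite /mix //=.
    by apply: harmonic_spanZ; exact: harmonic_spanD.
  by apply: harmonic_spanZ; apply: harmonic_spanD => //; exact: harmonic_spanZ.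
have j1 : lift ord0 ord0 = 1 :> 'I_3 by apply: val_inj.
have j2 : lift ord0 (lift ord0 ord0) = 2%:R :> 'I_3 by apply: val_inj.
exists (mix Ap Am A3), (mix Bp Bm B3); split.
- by move=> j; exact: mixP.
- by move=> j; exact: mixP.
- move=> j; apply/funext => x.
  have {}Ep := Ep x; have {}Em := Em x; have {}E3 := E3 x.
  rewrite /azimuthal iN in Ep Em.
  case: j => -[|[|[|//]]] hj.
  + rewrite (_ : Ordinal hj = 0); last exact: val_inj.
    rewrite -[LHS]/(xcoord 0 x * f x).
    rewrite -[RHS]/(2^-1 * (Ap x + Am x) + 2^-1 * (Bp x + Bm x)).
    apply: (mulfI two0); rewrite -mulrDr mulVKf //.
    by apply: (eq_lin Ep); apply: (eq_lin Em); ring.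
  + rewrite (_ : Ordinal hj = 1); last exact: val_inj.
    rewrite -[LHS]/(xcoord 1 x * f x).
    rewrite -[RHS]/((- imag_unit s / 2) * (Ap x + -1 * Am x)
      + (- imag_unit s / 2) * (Bp x + -1 * Bm x)).
    apply: (mulfI two0).
    apply: (eq_lin (congr1 (fun c => - imag_unit s * c) Ep)).
    apply: (eq_lin (congr1 (fun c => imag_unit s * c) Em)).
    by apply: (eq_lin (congr1 (fun c => 2 * xcoord 1 x * f x * c) i2)); field.
  + by rewrite (_ : Ordinal hj = 2%:R); last exact: val_inj.
- apply/funext => x; have {}Ec := Ec x.
  rewrite !big_ord_recl big_ord0 addr0 j1 j2.
  rewrite -[RHS]/(l%:R / (2 * l).+1%:R * f x).
  rewrite -[LHS]/(xcoord 0 x * (2^-1 * (Ap x + Am x)) +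
    (xcoord 1 x * ((- imag_unit s / 2) * (Ap x + -1 * Am x)) + xcoord 2%:R x * A3 x)).
  apply: (mulfI two0); rewrite /azimuthal iN in Ec.
  by apply: (eq_lin Ec); field.
Qed.

Lemma degree_split_solid s l k : degree_split l (solid s l k).
Proof.
have d0 : (2 * l).+1%:R != 0 :> C by rewrite pnatr_eq0.
pose d : C := ((2 * l).+1%:R)^-1.
have hs t n j c : harmonic_span n (c *: solid t n j).
  by apply: harmonic_spanZ; exact: harmonic_span_solid.
have dE (a b : C) : a * (2 * l).+1%:R = b -> a = d * b.
  by move=> <-; rewrite mulrCA mulVf // mulr1.
have hornerP (p q : {poly R}) x : p = q ->
    (p.[val x 0 2%:R])%:C%C = (q.[val x 0 2%:R])%:C%C :> C by move=> ->.
case: k => [|k].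
(* In order 0 both azimuthal factors raise the order, because [solid s l 0] is the same for both
   signs. *)
- apply: (@degree_split_azimuthal s l _
    (- d *: solid s l.-1 1) (- d *: solid (~~ s) l.-1 1) ((d * l%:R) *: solid s l.-1 0)
    (d *: solid s l.+1 1) (d *: solid (~~ s) l.+1 1) ((d * l.+1%:R) *: solid s l.+1 0))
    => // x.
  + rewrite (dE _ _ (solid_raise s l 0 x)).
    by rewrite -[RHS]/(- d * _ + d * _); ring.
  + rewrite -(solid0N s) (dE _ _ (solid_raise (~~ s) l 0 x)).
    by rewrite -[RHS]/(- d * _ + d * _); ring.
  + rewrite (dE _ _ (solid_x3 s l 0 x)).
    by rewrite -[RHS]/(d * l%:R * _ + d * l.+1%:R * _); ring.
  + have := hornerP _ _ x (legendre_christoffel_pred R l).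
    rewrite /= -!polyC_natr -polyC1 !(hornerMX, hornerX, hornerD, hornerM, hornerN, hornerC).
    rewrite !(rmorphD, rmorphM, rmorphN, rmorph_nat, rmorph1) /=.
    rewrite -[(val x 0 2%:R)%:C%C]/(xcoord 2%:R x) -(azimuthalM s) => E.
    rewrite -[LHS]/(azimuthal s x * (- d * solid (~~ s) l.-1 1 x)
      + azimuthal (~~ s) x * (- d * solid s l.-1 1 x)
      + 2 * (xcoord 2%:R x * (d * l%:R * solid s l.-1 0 x))).
    rewrite -[_ / _]/(l%:R * d) /solid derivn1 !derivn0 !expr1 !expr0.
    by apply: (eq_lin (congr1 (fun c => - (2 * d) * c) E)); ring.
(* In positive order one azimuthal factor raises and the other lowers: [a] and [b] are the
   coefficients of [solid_lower], [a3] and [b3] those of [solid_x3]. *)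
- pose a : C := d * ((l%:R + k.+1%:R) * (l%:R + k%:R)).
  pose b : C := - d * ((l%:R - k%:R) * (l.+1%:R - k%:R)).
  pose a3 : C := d * (l%:R + k.+1%:R).
  pose b3 : C := d * (l.+1%:R - k.+1%:R).
  apply: (@degree_split_azimuthal s l _
    (- d *: solid s l.-1 k.+2) (a *: solid s l.-1 k) (a3 *: solid s l.-1 k.+1)
    (d *: solid s l.+1 k.+2) (b *: solid s l.+1 k) (b3 *: solid s l.+1 k.+1))
    => // x.
  + rewrite (dE _ _ (solid_raise s l k.+1 x)).
    by rewrite -[RHS]/(- d * _ + d * _); ring.
  + rewrite (dE _ _ (solid_lower s l k x)).
    by rewrite -[RHS]/(a * _ + b * _) /a /b; ring.
  + rewrite (dE _ _ (solid_x3 s l k.+1 x)).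
    by rewrite -[RHS]/(a3 * _ + b3 * _) /a3 /b3; ring.
  + have := hornerP _ _ x (legendre_christoffel_derivn R l k).
    rewrite /= -!polyC_natr -polyC1 !(hornerMX, hornerX, hornerD, hornerM, hornerN, hornerC).
    rewrite !(rmorphD, rmorphM, rmorphN, rmorph_nat, rmorph1) /=.
    rewrite -[(val x 0 2%:R)%:C%C]/(xcoord 2%:R x) -(azimuthalM s) => E.
    rewrite -[LHS]/(azimuthal s x * (a * solid s l.-1 k x)
      + azimuthal (~~ s) x * (- d * solid s l.-1 k.+2 x)
      + 2 * (xcoord 2%:R x * (a3 * solid s l.-1 k.+1 x))).
    rewrite -[_ / _]/(l%:R * d) /solid /a /a3 !exprS.
    by apply: (eq_lin (congr1 (fun c => - d * azimuthal s x ^+ k * azimuthal s x * c) E)); ring.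
Qed.

Let mulZr (c : C) (f g : sphere R -> C) : f * (c *: g) = c *: (f * g).
Proof. by apply/funext => x; exact: mulrCA. Qed.

Lemma harmonic_span_split l f : harmonic_span l f -> degree_split l f.
Proof.
elim=> {f} [|m _|f g _ [A [B [hA hB AB cA]]] _ [A' [B' [hA' hB' AB' cA']]]
  |c f _ [A [B [hA hB AB cA]]]].
- exists (fun=> 0), (fun=> 0); split=> [j|j|j|]; try exact: harmonic_span0.
    by rewrite mulr0 addr0.
  by rewrite scaler0 big1 // => j _; rewrite mulr0.
- rewrite Ylm_solid; have [A [B [hA hB AB cA]]] := degree_split_solid (m < 0) l `|m|.
  exists (fun j => harmonic_coef l `|m| *: A j), (fun j => harmonic_coef l `|m| *: B j).
  split=> [j|j|j|]; try exact: harmonic_spanZ.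
    by rewrite mulZr AB scalerDr.
  rewrite scalerA mulrC -scalerA -cA scaler_sumr.
  by apply: eq_bigr => j _; rewrite mulZr.
- exists (fun j => A j + A' j), (fun j => B j + B' j).
  split=> [j|j|j|]; try exact: harmonic_spanD.
    by rewrite mulrDr AB AB' addrACA.
  rewrite scalerDr -cA -cA' -big_split /=.
  by apply: eq_bigr => j _; rewrite mulrDr.
- exists (fun j => c *: A j), (fun j => c *: B j).
  split=> [j|j|j|]; try exact: harmonic_spanZ.
    by rewrite mulZr AB scalerDr.
  rewrite scalerA mulrC -scalerA -cA scaler_sumr.
  by apply: eq_bigr => j _; rewrite mulZr.
Qed.

End SolidHarmonics.

(** * Integration over the sphere *)

Section Integration.
Local Open Scope classical_set_scope.
Variable R : realType.
Local Notation C := R[i].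
Local Notation P := (@legendre R).
Local Notation mu := (@lebesgue_measure R).
Local Notation box := (@angle_box R).
Local Notation nu := (@angle_measure R).

Lemma Rintegral_derive (f F : R -> R) (a b : R) : a < b ->
  (forall x : R, is_derive x (1 : R) F (f x)) -> continuous f ->
  (\int[mu]_(x in `[a, b]) f x = F b - F a)%R.
Proof.
move=> ab dF cf.
have cF : continuous F by move=> x; apply/differentiable_continuous/derivable1_diffP.
rewrite /Rintegral (@continuous_FTC2 _ f F) //.
- exact: continuous_subspaceT.
- by split=> [x _||]; [exact: ex_derive|apply: cvg_at_right_filter; exact: cF|apply: cvg_at_left_filter; exact: cF].
- by move=> x _; rewrite derive1E; exact: derive_val.
Qed.

Lemma continuous_integrable (f : R -> R) (a b : R) : continuous f ->
  mu.-integrable `[a, b] (EFin \o f).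
Proof.
move=> cf; apply: continuous_compact_integrable; first exact: segment_compact.
exact: continuous_subspaceT.
Qed.

(** * Integrability on the box of angles *)

Lemma measurable_box : measurable box.
Proof. exact: measurableX. Qed.

Lemma box_lty : (nu box < +oo)%E.
Proof.
rewrite /nu /angle_measure /box product_measure1E //.
have itv_lty (a c : R) : (mu `[a, c] < +oo)%E.
  by rewrite lebesgue_measure_itv /=; case: ifP => // _; rewrite -EFinD ltry.
by apply: lte_mul_pinfty; [exact: measure_ge0|rewrite ge0_fin_numE ?measure_ge0//|];
  exact: itv_lty.
Qed.

(** A class that is stable under sums and products and integrable on the box, which has finite
    measure; integrability of polynomials thus reduces to [sin] and [cos]. *)
Definition bounded_measurable (g : angle_space R -> R) :=
  measurable_fun setT g /\ exists M, forall t, `|g t| <= M.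

Lemma bounded_measurable_integrable g : bounded_measurable g ->
  nu.-integrable box (EFin \o g).
Proof.
move=> [mg [M gM]]; apply: measurable_bounded_integrable.
- exact: measurable_box.
- exact: box_lty.
- exact: measurable_funS mg.
- by exists M; split; [exact: num_real|move=> y My t _; exact: le_trans (gM t) (ltW My)].
Qed.

Lemma bounded_measurable_cst c : bounded_measurable (cst c).
Proof. by split; [exact: measurable_cst|exists `|c|]. Qed.

Lemma bounded_measurableD g h : bounded_measurable g -> bounded_measurable h ->
  bounded_measurable (fun t => g t + h t).
Proof.
move=> [mg [M gM]] [mh [N hN]]; split; first exact: measurable_funD.
by exists (M + N) => t; apply: le_trans (ler_normD _ _) _; exact: lerD.
Qed.

Lemma bounded_measurableM g h : bounded_measurable g -> bounded_measurable h ->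
  bounded_measurable (fun t => g t * h t).
Proof.
move=> [mg [M gM]] [mh [N hN]]; split; first exact: measurable_funM.
by exists (M * N) => t; rewrite normrM; exact: ler_pM.
Qed.

Lemma bounded_measurableB g h : bounded_measurable g -> bounded_measurable h ->
  bounded_measurable (fun t => g t - h t).
Proof.
move=> hg hh; have := bounded_measurableD hg (bounded_measurableM (bounded_measurable_cst (-1)) hh).
by congr bounded_measurable; apply/funext => t; rewrite /= mulN1r.
Qed.

Lemma bounded_measurable_fst (f : R -> R) M : continuous f ->
  (forall x, `|f x| <= M) -> bounded_measurable (fun t => f t.1).
Proof.
move=> cf fM; split; last by exists M.
apply: (measurableT_comp _ measurable_fst); exact: continuous_measurable_fun.
Qed.

Lemma bounded_measurable_snd (f : R -> R) M : continuous f ->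
  (forall x, `|f x| <= M) -> bounded_measurable (fun t => f t.2).
Proof.
move=> cf fM; split; last by exists M.
apply: (measurableT_comp _ measurable_snd); exact: continuous_measurable_fun.
Qed.

Let sin1 (x : R) : `|sin x| <= 1. Proof. by rewrite ler_norml sin_geN1 sin_le1. Qed.
Let cos1 (x : R) : `|cos x| <= 1. Proof. by rewrite ler_norml cos_geN1 cos_le1. Qed.

Lemma bounded_measurable_sin1 : bounded_measurable (fun t => sin t.1).
Proof. exact: (bounded_measurable_fst (@continuous_sin R) sin1). Qed.

Lemma bounded_measurable_polynomial f : polynomial_fun f ->
  bounded_measurable (fun t => complex.Re (f (of_angles t))) /\
  bounded_measurable (fun t => complex.Im (f (of_angles t))).
Proof.
elim=> {f} [c|j|f g _ [hf1 hf2] _ [hg1 hg2]|f g _ [hf1 hf2] _ [hg1 hg2]].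
- by split; exact: bounded_measurable_cst.
- split; last exact: bounded_measurable_cst.
  have c1 := bounded_measurable_fst (@continuous_cos R) cos1.
  have c2 := bounded_measurable_snd (@continuous_cos R) cos1.
  have s2 := bounded_measurable_snd (@continuous_sin R) sin1.
  have s1 := bounded_measurable_sin1.
  case: j => -[|[|[|//]]] hj.
  + have := bounded_measurableM c2 s1; congr bounded_measurable.
    by apply/funext => t; rewrite /= mxE.
  + have := bounded_measurableM s2 s1; congr bounded_measurable.
    by apply/funext => t; rewrite /= mxE.
  + by move: c1; congr bounded_measurable; apply/funext => t; rewrite /= mxE.
- split.
    have := bounded_measurableD hf1 hg1; congr bounded_measurable.
    by apply/funext => t /=; rewrite -[(f + g) _]/(f _ + g _); case: (f _) (g _) => ? ? [].
  have := bounded_measurableD hf2 hg2; congr bounded_measurable.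
  by apply/funext => t /=; rewrite -[(f + g) _]/(f _ + g _); case: (f _) (g _) => ? ? [].
- split.
    have := bounded_measurableB (bounded_measurableM hf1 hg1) (bounded_measurableM hf2 hg2).
    congr bounded_measurable; apply/funext => t /=.
    by rewrite -[(f * g) _]/(f _ * g _); case: (f _) (g _) => ? ? [].
  have := bounded_measurableD (bounded_measurableM hf1 hg2) (bounded_measurableM hf2 hg1).
  congr bounded_measurable; apply/funext => t /=.
  by rewrite -[(f * g) _]/(f _ * g _); case: (f _) (g _) => ? ? [].
Qed.

Lemma polynomial_L2 (f : sphere R -> C) : polynomial_fun f -> L2 f.
Proof.
move=> /bounded_measurable_polynomial[h1 h2]; split.
- exact: measurable_funS h1.1.
- exact: measurable_funS h2.1.
have h := bounded_measurableM (bounded_measurableD (bounded_measurableM h1 h1)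
  (bounded_measurableM h2 h2)) bounded_measurable_sin1.
(* The integrand is bounded and measurable, so its absolute value has a finite integral, which
   dominates the required one. *)
have /integrableP[_] := bounded_measurable_integrable h.
apply: le_lt_trans; apply: ge0_le_integral => //.
- exact: measurable_box.
- move=> t [+ _] => /=; rewrite in_itv /= => t1.
  by rewrite lee_fin mulr_ge0 ?sqnormc_ge0 // sin_ge0_pi.
- by apply/measurable_EFinP; apply: measurable_funS h.1.
- by apply: measurableT_comp => //; apply/measurable_EFinP; apply: measurable_funS h.1.
- move=> t _; rewrite /= lee_fin; exact: ler_norm.
Qed.

(** * Linearity of integration and of the embedding of functions *)

Lemma sphere_RintegralD (f g : sphere R -> R) :
  bounded_measurable (f \o @of_angles R) -> bounded_measurable (g \o @of_angles R) ->
  sphere_Rintegral (fun x => f x + g x) = sphere_Rintegral f + sphere_Rintegral g.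
Proof.
move=> hf hg; rewrite /sphere_Rintegral -RintegralD.
- by apply: eq_Rintegral => t _; rewrite mulrDl.
- exact: measurable_box.
- exact: bounded_measurable_integrable (bounded_measurableM hf bounded_measurable_sin1).
- exact: bounded_measurable_integrable (bounded_measurableM hg bounded_measurable_sin1).
Qed.

Lemma sphere_RintegralZ c (f : sphere R -> R) : bounded_measurable (f \o @of_angles R) ->
  sphere_Rintegral (fun x => c * f x) = c * sphere_Rintegral f.
Proof.
move=> hf; rewrite /sphere_Rintegral -RintegralZl.
- by apply: eq_Rintegral => t _; rewrite mulrA.
- exact: measurable_box.
- exact: bounded_measurable_integrable (bounded_measurableM hf bounded_measurable_sin1).
Qed.

Lemma sphere_integral_linear c (f g : sphere R -> C) : polynomial_fun f -> polynomial_fun g ->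
  sphere_integral (c *: f + g) = c * sphere_integral f + sphere_integral g.
Proof.
move=> /bounded_measurable_polynomial[f1 f2] /bounded_measurable_polynomial[g1 g2].
rewrite /sphere_integral; case: c => a b; apply/eqP; rewrite eq_complex /=.
have bc r h : bounded_measurable (fun t => h (of_angles t)) ->
    bounded_measurable (fun t => r * h (of_angles t)).
  by move=> hh; apply: bounded_measurableM => //; exact: bounded_measurable_cst.
have ef x : (((a +i* b)%C *: f + g) x) = (a +i* b)%C * f x + g x by [].
apply/andP; split; apply/eqP.
  transitivity (sphere_Rintegral (fun x =>
      a * complex.Re (f x) + (- b * complex.Im (f x) + complex.Re (g x)))).
    congr sphere_Rintegral; apply/funext => x; rewrite ef.
    by case: (f x) (g x) => ? ? [? ?] /=; ring.
  rewrite sphere_RintegralD; [|exact: (bc _ (fun x => complex.Re (f x)) f1)|exact: bounded_measurableD (bc _ (fun x => complex.Im (f x)) f2) g1].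
  rewrite sphere_RintegralD; [|exact: (bc _ (fun x => complex.Im (f x)) f2)|exact: g1].
  by rewrite !sphere_RintegralZ //; ring.
transitivity (sphere_Rintegral (fun x =>
    a * complex.Im (f x) + (b * complex.Re (f x) + complex.Im (g x)))).
  congr sphere_Rintegral; apply/funext => x; rewrite ef.
  by case: (f x) (g x) => ? ? [? ?] /=; ring.
rewrite sphere_RintegralD; [|exact: (bc _ (fun x => complex.Im (f x)) f2)|exact: bounded_measurableD (bc _ (fun x => complex.Re (f x)) f1) g2].
  rewrite sphere_RintegralD; [|exact: (bc _ (fun x => complex.Re (f x)) f1)|exact: g2].
  by rewrite !sphere_RintegralZ //; ring.
Qed.

Lemma test_fun_polynomial (g : testfun R) : polynomial_fun (test_fun g).
Proof. by case: g => g /= /asboolP. Qed.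

Lemma gfun_of_scalar (f : sphere R -> C) : polynomial_fun f -> scalar (gfun_of f).
Proof.
move=> pf c g h; rewrite /gfun_of.
have -> : f * test_fun (c *: g + h) = c *: (f * test_fun g) + f * test_fun h.
  apply/funext => x.
  rewrite -[LHS]/(f x * (c * test_fun g x + test_fun h x)).
  rewrite -[RHS]/(c * (f x * test_fun g x) + f x * test_fun h x); ring.
by apply: sphere_integral_linear; apply: polynomial_mul => //; exact: test_fun_polynomial.
Qed.

Lemma gfun_of_linear c (f g : sphere R -> C) : polynomial_fun f -> polynomial_fun g ->
  gfun_of (c *: f + g) = c *: gfun_of f + gfun_of g.
Proof.
move=> pf pg; apply/funext => h; rewrite /gfun_of.
have -> : (c *: f + g) * test_fun h = c *: (f * test_fun h) + g * test_fun h.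
  apply/funext => x.
  rewrite -[LHS]/((c * f x + g x) * test_fun h x).
  rewrite -[RHS]/(c * (f x * test_fun h x) + g x * test_fun h x); ring.
by apply: sphere_integral_linear; apply: polynomial_mul => //; exact: test_fun_polynomial.
Qed.

Lemma gfun_of0 : gfun_of 0 = 0 :> gfun R.
Proof.
have p0 := @polynomial_cst R 0.
by have := gfun_of_linear (-1) p0 p0; rewrite !scaleN1r !addNr.
Qed.

(** The pairing is bilinear, so a coordinate moves from the test function to the function. *)
Lemma gmul_gfun_of j (f : sphere R -> C) : gmul j (gfun_of f) = gfun_of (xcoord j * f) :> gfun R.
Proof.
apply/funext => h; rewrite /gmul /gfun_of; congr sphere_integral.
apply/funext => x; rewrite -[LHS]/(f x * (xcoord j x * test_fun h x)).
by rewrite mulrCA mulrA.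
Qed.

End Integration.

(** * Orthogonality *)

Section NullPolynomials.
Variable R : realType.
Local Notation P := (@legendre R).
Local Notation u := ('X^2 - 1 : {poly R}).
Implicit Types p q v : {poly R}.

(* Says that the integral of [q] over [-1, 1] is zero. *)
Definition null_poly q := exists2 Q : {poly R}, Q^`() = q & Q.[1] = Q.[-1].

Lemma null_poly0 : null_poly 0.
Proof. by exists 0; rewrite ?derivC ?horner0. Qed.

Lemma null_polyZ c q : null_poly q -> null_poly (c *: q).
Proof. by move=> [Q <- E]; exists (c *: Q); rewrite ?derivZ // !hornerZ E. Qed.

Lemma dvdp_exp_deriv p q k : p ^+ k %| q -> p ^+ k.-1 %| q^`().
Proof.
case: k => [|k]; first by rewrite !expr0 !dvd1p.
move=> /dvdpP[r ->]; rewrite derivM deriv_exp /= dvdp_add //.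
  by rewrite exprS mulrA dvdp_mulIr.
by rewrite -mulr_natr -!mulrA dvdp_mull // dvdp_mull // dvdp_mulIl.
Qed.

Lemma dvdp_exp_derivn p k i : p ^+ (k - i) %| (p ^+ k)^`(i).
Proof.
elim: i => [|i IH]; first by rewrite subn0 derivn0 dvdpp.
by rewrite derivnS subnS; exact: dvdp_exp_deriv.
Qed.

Lemma dvdp_root1 k v : (0 < k)%N -> u ^+ k %| v -> v.[1] = 0 /\ v.[-1] = 0.
Proof.
have E1 : u.[1] = 0 by rewrite hornerD hornerN hornerXn hornerC expr1n subrr.
have E2 : u.[-1] = 0 by rewrite hornerD hornerN hornerXn hornerC sqrrN expr1n subrr.
case: k => // k _ /dvdpP[r ->].
by rewrite [_ ^+ k.+1]exprS !hornerM E1 E2 !mul0r !mulr0.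
Qed.

(* Repeated integration by parts: the boundary terms vanish because [X^2 - 1] divides
   the derivative when [i < n], and [v] when [n <= i]. *)
Lemma null_poly_rodrigues n i v : u ^+ (i - n) %| v -> (size v <= i)%N ->
  null_poly ((u ^+ n)^`(i) * v).
Proof.
elim: i v => [|i IH] v; first by rewrite size_poly_leq0 => _ /eqP ->; rewrite mulr0; exact: null_poly0.
move=> dv sv.
have [||Q QE Q1] := IH v^`().
- by have := dvdp_exp_deriv dv; congr (_ ^+ _ %| _); lia.
- case: (eqVneq v 0) => [->|v0]; first by rewrite derivC size_poly0.
  by rewrite -ltnS; apply: leq_trans (lt_size_deriv v0) sv.
(* One integration by parts: [Q] is the primitive that the induction gives for the product with
   [v']. *)
exists ((u ^+ n)^`(i) * v - Q).
  by rewrite derivB derivM -derivnS QE addrK.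
suff [E1 E2] : ((u ^+ n)^`(i) * v).[1] = 0 /\ ((u ^+ n)^`(i) * v).[-1] = 0.
  by rewrite hornerD hornerN [RHS]hornerD hornerN E1 E2 Q1.
rewrite !hornerM; have [i_n|n_i] := ltnP i n.
  have [||-> ->] := @dvdp_root1 (n - i) (u ^+ n)^`(i); last by rewrite !mul0r.
    by rewrite subn_gt0.
  exact: dvdp_exp_derivn.
have [||-> ->] := @dvdp_root1 (i.+1 - n) v; last by rewrite !mulr0.
  by rewrite subn_gt0.
by [].
Qed.

Lemma size_derivn_leq p n : (size p^`(n) <= size p - n)%N.
Proof.
elim: n => [|n IH]; first by rewrite derivn0 subn0.
rewrite derivnS; have [->|p0] := eqVneq p^`(n) 0.
  by rewrite derivC size_poly0.
by have := lt_size_deriv p0; lia.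
Qed.

(** By Rodrigues' formula the last factor is a derivative of order [l' + k], while the product of
    the others has degree at most [l + k < l' + k] and is divisible by [(X^2 - 1)^k], as
    [null_poly_rodrigues] requires. *)
Lemma null_poly_legendre l l' k : (l < l')%N ->
  null_poly ((1 - 'X^2) ^+ k * (P l)^`(k) * (P l')^`(k)).
Proof.
move=> ll'.
pose v := (-1) ^+ k *: (u ^+ k * (P l)^`(k)).
have -> : (1 - 'X^2) ^+ k * (P l)^`(k) * (P l')^`(k) =
    (2 ^+ l' * l'`!%:R)^-1 *: ((u ^+ l')^`(l' + k) * v).
  rewrite [in LHS](derivn_legendre R l') /v; set a := (_ * _)^-1.
  have -> : (1 - 'X^2) ^+ k = (-1) ^+ k * u ^+ k by rewrite -exprNn opprB.
  by rewrite -!mul_polyC polyC_exp polyCN polyC1; ring.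
apply/null_polyZ/null_poly_rodrigues.
  by rewrite addKn /v dvdpZr ?signr_eq0 // dvdp_mulIl.
rewrite /v size_scale ?signr_eq0 //.
have [kl|lk] := leqP k l; last by rewrite derivn_legendre_eq0 // mulr0 size_poly0.
apply: leq_trans (size_polyMleq _ _) _.
have s1 := size_rodrigues R k.
have s2 : (size (P l)^`(k) <= l.+1 - k)%N.
  rewrite derivn_legendre; apply: leq_trans (size_scale_leq _ _) _.
  apply: leq_trans (size_derivn_leq _ _) _.
  by have := size_rodrigues R l; lia.
rewrite -subn1 leq_subLR add1n.
by apply: leq_trans (leq_add s1 s2) _; lia.
Qed.

End NullPolynomials.

(** * Orthogonality of harmonics of different degrees *)

Section Orthogonality.
Local Open Scope classical_set_scope.
Variable R : realType.
Local Notation C := R[i].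
Local Notation P := (@legendre R).
Local Notation mu := (@lebesgue_measure R).
Local Notation box := (@angle_box R).
Local Notation nu := (@angle_measure R).

Lemma Rintegral_box_prod (h g : R -> R) : continuous h -> continuous g ->
  nu.-integrable box (fun t => (h t.1 * g t.2)%:E) ->
  \int[nu]_(t in box) (h t.1 * g t.2) =
  (\int[mu]_(x in `[0, pi]) h x) * (\int[mu]_(y in `[0, 2 * pi]) g y).
Proof.
move=> ch cg int_hg.
have ih := continuous_integrable 0 pi ch.
have ig := continuous_integrable 0 (2 * pi) cg.
rewrite /Rintegral.
have mI (a b : R) : measurable (`[a, b] : set (measurableTypeR R)) by [].
have fin_h : (\int[mu]_(x in `[0%R, pi]) (h x)%:E \is a fin_num)%E.
  by apply: integrable_fin_num.
have fin_g : (\int[mu]_(x in `[0%R, (2 * pi)%R]) (g x)%:E \is a fin_num)%E.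
  by apply: integrable_fin_num.
rewrite -fineM //; congr fine.
(* Fubini's theorem is applied to extensions by zero to the whole plane; the indicator of the box is
   the product of those of the two intervals. *)
rewrite integral_mkcond -[LHS]integral12_prod_meas1; last first.
  exact: ((integrable_mkcond _ (@measurable_box R)).1 int_hg).
rewrite [in RHS]integral_mkcond.
rewrite -(fineK fin_g) -integralZr //; last first.
  exact: ((integrable_mkcond _ (mI _ _)).1 ih).
apply: eq_integral => x _; rewrite fineK //.
rewrite /fubini_F [in RHS]integral_mkcond.
have box_in y : ((x, y) \in box) = (x \in (`[0, pi] : set R)) && (y \in (`[0, 2 * pi] : set R)).
  by rewrite /angle_box in_setX.
(* The default value of [patch] is [point], which is 0 here. *)
have pt : point = 0%E :> \bar R by [].
rewrite /patch !pt; under eq_integral do rewrite box_in; case: ifPn => hx /=.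
  rewrite -integralZl //; last exact: ((integrable_mkcond _ (mI _ _)).1 ig).
  by apply: eq_integral => y _; case: ifP => _; rewrite ?mule0.
by rewrite mul0e integral0_eq.
Qed.

(** The substitution [x = cos theta], carried out with [- Q(cos theta)] as an explicit primitive. *)
Lemma integral_null_poly (q : {poly R}) : null_poly q ->
  \int[mu]_(x in `[0, pi]) (q.[cos x] * sin x) = 0.
Proof.
move=> [Q QE Q1].
have dF (x : R) : is_derive x (1 : R) (fun x => - Q.[cos x]) (q.[cos x] * sin x).
  have := @is_derive1_comp R (horner Q) cos x _ _ (is_derive_poly Q (cos x)) (is_derive_cos x).
  by move=> /is_deriveN; rewrite QE mulrN opprK; exact.
have cf : continuous (fun x : R => q.[cos x] * sin x).
  move=> x; apply: (@continuousM _ _ (fun x => q.[cos x]) sin x); last exact: continuous_sin.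
  apply: continuous_comp; first exact: continuous_cos.
  exact: continuous_horner.
by rewrite (Rintegral_derive (pi_gt0 R) dF cf) cospi cos0 Q1 subrr.
Qed.

Lemma cos_period (n : int) : cos (n%:~R * (2 * pi)) = 1 :> R /\ sin (n%:~R * (2 * pi)) = 0 :> R.
Proof.
have E : cis (2 * pi) = 1 :> C.
  by rewrite /cis mulr_natl cos2pi sin2pi.
have h k : cos (k%:R * (2 * pi)) = 1 :> R /\ sin (k%:R * (2 * pi)) = 0 :> R.
  by have := cisM k (2 * pi : R); rewrite E expr1n => -[].
case: n => k; first exact: h.
by rewrite NegzE mulrNz mulNr cosN sinN; have [-> ->] := h k.+1; rewrite oppr0.
Qed.

Let is_derive_lin (n x : R) : is_derive x (1 : R) (fun y => n * y) n.
Proof.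
have := @is_deriveZ _ _ _ id n x 1 1 (is_derive_id x 1); by rewrite /GRing.scale /= mulr1.
Qed.

Lemma integral_cos_period (n : int) : n != 0 ->
  \int[mu]_(x in `[0, 2 * pi]) cos (n%:~R * x) = 0 /\
  \int[mu]_(x in `[0, 2 * pi]) sin (n%:~R * x) = 0.
Proof.
move=> n0; have nR : n%:~R != 0 :> R by rewrite intr_eq0.
have pi0 : 0 < 2 * pi :> R by rewrite mulr_gt0 ?pi_gt0.
have [c1 s0] := cos_period n.
have clin : continuous (fun x : R => n%:~R * x).
  by move=> x; apply: (@continuousM _ _ (cst n%:~R) id x); [exact: cst_continuous|exact: cvg_id].
split.
- have dF (x : R) : is_derive x (1 : R) (fun x => n%:~R^-1 * sin (n%:~R * x)) (cos (n%:~R * x)).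
    have := is_derive1_comp (is_derive_sin (n%:~R * x)) (is_derive_lin n%:~R x).
    move=> /(@is_deriveZ _ _ _ _ n%:~R^-1) /=.
    by rewrite /GRing.scale /= mulrCA mulVf // mulr1; exact.
  rewrite (Rintegral_derive pi0 dF) ?s0 ?mulr0 ?sin0 ?mulr0 ?subrr //.
  by move=> x; apply: continuous_comp; [exact: clin|exact: continuous_cos].
- have dF (x : R) : is_derive x (1 : R) (fun x => - n%:~R^-1 * cos (n%:~R * x)) (sin (n%:~R * x)).
    have := is_derive1_comp (is_derive_cos (n%:~R * x)) (is_derive_lin n%:~R x).
    move=> /(@is_deriveZ _ _ _ _ (- n%:~R^-1)) /=.
    by rewrite /GRing.scale /= [- sin _ * _]mulNr mulrNN mulrCA mulVf // mulr1; exact.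
  rewrite (Rintegral_derive pi0 dF) ?c1 ?mulr0 ?cos0 ?subrr //.
  by move=> x; apply: continuous_comp; [exact: clin|exact: continuous_sin].
Qed.

Lemma polynomial_solid s l k : polynomial_fun (@solid R s l k).
Proof.
pose f : sphere R -> C := xcoord 0 + cst (imag_unit R s) * xcoord 1.
have -> : solid s l k = f ^+ k * (fun x => ((P l)^`(k).[val x 0 2%:R])%:C%C).
  apply/funext => x; rewrite -[RHS]/((f ^+ k) x * _); congr (_ * _).
  by elim: k => [|k IH] //; rewrite !exprS -[RHS]/(_ * (f ^+ k) x) -IH.
apply: polynomial_mul; last exact: polynomial_horner.
apply: polynomial_exp; apply: polynomial_add; first exact: polynomial_coord.
by apply: polynomial_mul; [exact: polynomial_cst|exact: polynomial_coord].
Qed.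

Lemma harmonic_span_polynomial l (f : sphere R -> C) : harmonic_span l f -> polynomial_fun f.
Proof.
elim=> {f} [|m _|f g _ pf _ pg|c f _ pf].
- exact: (polynomial_cst 0).
- by rewrite Ylm_solid; apply: polynomialZ; exact: polynomial_solid.
- exact: polynomial_add.
- exact: polynomialZ.
Qed.

(** In angles the integrand separates into a function of [theta] times [exp(i n phi)], with [n] the
    sum of the signed orders. If [n] is nonzero the azimuthal integral vanishes; if [n = 0] the
    orders agree and [null_poly_legendre] kills the integral in [theta]. *)
Lemma solid_orthogonal s s' l l' k k' : (l < l')%N ->
  sphere_integral (solid s l k * solid s' l' k' : sphere R -> C) = 0.
Proof.
move=> ll'.
pose n : int := (-1) ^+ s * k%:Z + (-1) ^+ s' * k'%:Z.
pose h (x : R) : R := sin x ^+ k * ((P l)^`(k)).[cos x] *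
  (sin x ^+ k' * ((P l')^`(k')).[cos x]) * sin x.
have prodE (t : R * R) : (solid s l k * solid s' l' k') (of_angles t) =
    cis (n%:~R * t.2) * (sin t.1 ^+ k * ((P l)^`(k)).[cos t.1] *
      (sin t.1 ^+ k' * ((P l')^`(k')).[cos t.1]))%:C%C.
  rewrite -[LHS]/(solid _ _ _ _ * solid _ _ _ _) !solid_angles.
  rewrite mulrACA -cisD -rmorphM; congr (cis _ * _).
  by rewrite /n rmorphD !rmorphM !rmorph_sign /= !mulrA -mulrDl.
have ch : continuous h.
  have c1 j : continuous (fun x : R => sin x ^+ j).
    move=> x; apply: (@continuous_comp _ _ _ sin (fun y : R => y ^+ j)).
      exact: continuous_sin.
    exact: exprn_continuous.
  have c2 (q : {poly R}) : continuous (fun x : R => q.[cos x]).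
    by move=> x; apply: continuous_comp; [exact: continuous_cos|exact: continuous_horner].
  have cM (a b : R -> R) : continuous a -> continuous b -> continuous (fun x => a x * b x).
    by move=> ca cb x; apply: (@continuousM _ _ a b x); [exact: ca|exact: cb].
  by apply: (cM); [apply: (cM); apply: (cM)|exact: continuous_sin].
have clin : continuous (fun x : R => n%:~R * x).
  by move=> x; apply: (@continuousM _ _ (cst n%:~R) id x); [exact: cst_continuous|exact: cvg_id].
(* Treats real and imaginary parts at once: [H] is [Re] or [Im], and [g] correspondingly [cos] or
   [sin] of [n phi]. *)
have key (g : R -> R) (H : C -> R) : continuous g ->
    (forall z (r : R), H (z * r%:C%C) = H z * r) -> (forall y, H (cis (n%:~R * y)) = g y) ->
    bounded_measurable (fun t => H ((solid s l k * solid s' l' k') (of_angles t))) ->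
    (n != 0 -> \int[mu]_(y in `[0, 2 * pi]) g y = 0) ->
    sphere_Rintegral (fun x => H ((solid s l k * solid s' l' k') x)) = 0.
  move=> cg HM Hg bm g0; rewrite /sphere_Rintegral.
  have E (y : R * R) : H ((solid s l k * solid s' l' k') (of_angles y)) * sin y.1 = h y.1 * g y.2.
    by rewrite prodE HM Hg /h; ring.
  under eq_Rintegral do rewrite E.
  rewrite Rintegral_box_prod //; last first.
    have := bounded_measurable_integrable (bounded_measurableM bm (bounded_measurable_sin1 R)).
    by apply: eq_integrable; [exact: measurable_box|move=> t _; rewrite /= E].
  have [n0|n0] := eqVneq n 0; last by rewrite g0 // mulr0.
  (* [n = 0] says that the signed orders are opposite, so their absolute values agree. *)
  have kk' : k = k'.
    move: n0; rewrite /n.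
    by case: (s); case: (s'); rewrite ?expr0 ?expr1 ?mulN1r ?mul1r; lia.
  have np := null_poly_legendre R k ll'.
  under eq_Rintegral => x _.
    rewrite (_ : h x = ((1 - 'X^2) ^+ k * (P l)^`(k) * (P l')^`(k)).[cos x] * sin x); last first.
      rewrite /h -kk' !hornerM horner_exp hornerD hornerN hornerXn hornerC.
      by rewrite -sin2cos2 -exprM mul2n -addnn exprD; ring.
    over.
  by rewrite integral_null_poly // mul0r.
have [b1 b2] := bounded_measurable_polynomial
  (polynomial_mul (polynomial_solid s l k) (polynomial_solid s' l' k')).
rewrite /sphere_integral.
rewrite (key (fun y => cos (n%:~R * y)) (fun z => complex.Re z)) //; first last.
- by move=> /integral_cos_period[].
- by move=> [a b] r /=; ring.
- by move=> x; apply: continuous_comp; [exact: clin|exact: continuous_cos].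
rewrite (key (fun y => sin (n%:~R * y)) (fun z => complex.Im z)) //.
- by move=> x; apply: continuous_comp; [exact: clin|exact: continuous_sin].
- by move=> [a b] r /=; ring.
- by move=> /integral_cos_period[].
Qed.

Lemma conj_solid s l k x : conjc (@solid R s l k x) = solid (~~ s) l k x.
Proof.
rewrite -(anglesK x) !solid_angles.
have -> : (-1) ^+ (~~ s) = - (-1) ^+ s :> R by case: s; rewrite ?expr0 ?expr1 ?opprK.
by rewrite mulNr /cis cosN sinN; apply/eqP; rewrite eq_complex /=;
  apply/andP; split; apply/eqP; ring.
Qed.

Lemma coef_Ylm l m l' m' : (l < l')%N -> coef (gfun_of (@Ylm R l m)) l' m' = 0.
Proof.
move=> ll'; rewrite /coef /gfun_of /=.
pose f : sphere R -> C := solid (m < 0) l `|m| * solid (~~ (m' < 0)) l' `|m'|.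
pose c := harmonic_coef R l `|m| * harmonic_coef R l' `|m'|.
have pf : polynomial_fun f by apply: polynomial_mul; exact: polynomial_solid.
have -> : Ylm l m * (fun x => conjc (Ylm l' m' x)) = c *: f + 0.
  rewrite addr0; apply/funext => x; rewrite !Ylm_solid.
  rewrite -[LHS]/(harmonic_coef R l `|m| * solid _ _ _ x *
    conjc (harmonic_coef R l' `|m'| * solid (m' < 0) l' `|m'| x)).
  have cc : conjc (harmonic_coef R l' `|m'|) = harmonic_coef R l' `|m'|.
    exact: conjc_real.
  have conjM (a b : C) : conjc (a * b) = conjc a * conjc b by exact: rmorphM.
  rewrite conjM conj_solid cc -[RHS]/(c * (solid _ _ _ _ * solid _ _ _ _)).
  by rewrite /c; ring.
rewrite sphere_integral_linear // ?solid_orthogonal //; last exact: (polynomial_cst 0).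
rewrite mulr0 add0r.
have := sphere_integral_linear (-1) (polynomial_cst 0) (@polynomial_cst R 0).
by rewrite scaleN1r addNr mulN1r addNr.
Qed.

End Orthogonality.

(** * Sobolev spaces *)

Section Sobolev.
Variable R : realType.
Local Notation C := R[i].
Implicit Types (f g : sphere R -> C) (l : nat) (p r : R).

Lemma gfun_ofD f g : polynomial_fun f -> polynomial_fun g ->
  gfun_of (f + g) = gfun_of f + gfun_of g.
Proof. by move=> pf pg; rewrite -[f in LHS]scale1r gfun_of_linear // scale1r. Qed.

Lemma gfun_ofZ c f : polynomial_fun f -> gfun_of (c *: f) = c *: gfun_of f.
Proof.
move=> pf; rewrite -[c *: f in LHS]addr0 gfun_of_linear ?gfun_of0 ?addr0 //.
exact: (polynomial_cst 0).
Qed.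

Lemma Ylm_sobolev p l m : gfun_of (@Ylm R l m) \in @sobolev_pred R p.
Proof.
have pY : polynomial_fun (Ylm l m : sphere R -> C).
  by rewrite Ylm_solid; apply: polynomialZ; exact: polynomial_solid.
apply/asboolP; split; first exact: gfun_of_scalar.
(* The series is cut after degree [l]: beyond it all coefficients vanish by [coef_Ylm], so the
   energy is a finite sum whatever [p]. *)
rewrite /sobolev_energy (@nneseries_split _ _ 0%N l.+1); last first.
  by move=> k _; rewrite lee_fin mulr_ge0 ?powR_ge0 ?degree_energy_ge0.
rewrite eseries0 ?adde0; first by rewrite sumEFin ltry.
move=> k; rewrite add0n => lk _; rewrite /degree_energy big1 ?mulr0 // => j _.
by rewrite coef_Ylm // /sqnormc /= expr0n addr0.
Qed.

Lemma harmonic_span_sobolev p l f : harmonic_span l f ->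
  gfun_of f \in @sobolev_pred R p.
Proof.
have [mem0 memP] := @sobolev_submod R p.
elim=> {f} [|m _|f g hf sf hg sg|c f hf sf].
- by rewrite gfun_of0.
- exact: Ylm_sobolev.
- have pf := harmonic_span_polynomial hf; have pg := harmonic_span_polynomial hg.
  rewrite -[f]scale1r (gfun_of_linear 1 pf pg).
  exact: (memP 1 _ _ sf sg).
- have pf := harmonic_span_polynomial hf.
  by rewrite gfun_ofZ // -[_ *: _]addr0; exact: memP.
Qed.

(** Every combination of harmonics lies in [H^p], so each summand is itself an argument of [S], and
    linearity applies. Equality in [sobolev p] is equality of the underlying functionals. *)
Lemma diagonal_harmonic_span p r (S : {linear sobolev p -> sobolev r}) (s : nat -> C) :
  (forall (l : nat) (m : int), (`|m| <= l)%N ->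
     forall u : sobolev p, sobolev_gfun u = gfun_of (Ylm l m) ->
       sobolev_gfun (S u) = s l *: gfun_of (Ylm l m)) ->
  forall l f, harmonic_span l f ->
  forall u : sobolev p, sobolev_gfun u = gfun_of f ->
    sobolev_gfun (S u) = s l *: gfun_of f.
Proof.
move=> Sdiag l f; elim=> {f} [|m ml|f g hf Sf hg Sg|c f hf Sf] u uE.
- have -> : u = 0 by apply: val_inj; rewrite /= uE gfun_of0.
  by rewrite linear0 gfun_of0 scaler0.
- exact: Sdiag.
- have pf := harmonic_span_polynomial hf; have pg := harmonic_span_polynomial hg.
  pose uf := Sobolev (harmonic_span_sobolev p hf).
  pose ug := Sobolev (harmonic_span_sobolev p hg).
  have -> : u = uf + ug by apply: val_inj; rewrite /= uE gfun_ofD.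
  rewrite linearD gfun_ofD // scalerDr -(Sf uf) // -(Sg ug) //.
- have pf := harmonic_span_polynomial hf.
  pose uf := Sobolev (harmonic_span_sobolev p hf).
  have -> : u = c *: uf by apply: val_inj; rewrite /= uE gfun_ofZ.
  by rewrite linearZ gfun_ofZ // scalerA mulrC -scalerA -(Sf uf).
Qed.

End Sobolev.

(** * Diagonalization of the operator [S_n] *)

Unset Implicit Arguments.
Set Strict Implicit.

Theorem theorem4p2 (R : realType) (p r : R)
    (S : {linear sobolev p -> sobolev r}) (s : nat -> R[i])
    (S_continuous : sobolev_continuous S)
    (S_diagonal : forall (l : nat) (m : int), (`|m|%N <= l)%N ->
       forall u : sobolev p, sobolev_gfun u = gfun_of (Ylm l m) ->
         sobolev_gfun (S u) = s l *: gfun_of (Ylm l m)) :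
  forall (l : nat) (m : int), (`|m|%N <= l)%N ->
    S_normal S (Ylm l m) (normal_eigenvalue s l *: Ylm l m).
Proof.
move=> l m ml.
have hY : harmonic_span l (Ylm l m : sphere R -> R[i]) by exact: harmonic_span_Ylm.
have pY := harmonic_span_polynomial hY.
split; [exact: polynomial_L2|apply: polynomial_L2; exact: polynomialZ|].
have [A [B [hA hB AB cA]]] := harmonic_span_split hY.
have pA j := harmonic_span_polynomial (hA j).
have pB j := harmonic_span_polynomial (hB j).
pose uA j := Sobolev (harmonic_span_sobolev p (hA j)).
pose uB j := Sobolev (harmonic_span_sobolev p (hB j)).
(* The element of [H^p] representing [x_j Y_l^m] is given as a sum of its two degree components, on
   each of which [S] is a scalar. *)
exists (fun j => uA j + uB j) => [j|]; first by rewrite AB gfun_ofD.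
have pT j : polynomial_fun (xcoord j * (s l.-1 *: A j + s l.+1 *: B j)).
  apply: polynomial_mul; first exact: polynomial_coord.
  by apply: polynomial_add; exact: polynomialZ.
have SE j : gmul j (val (S (uA j + uB j))) =
    gfun_of (xcoord j * (s l.-1 *: A j + s l.+1 *: B j)).
  rewrite -gmul_gfun_of gfun_ofD ?gfun_ofZ //; try exact: polynomialZ.
  rewrite linearD.
  by rewrite -(diagonal_harmonic_span S_diagonal (hA j) (u := uA j)) //
    -(diagonal_harmonic_span S_diagonal (hB j) (u := uB j)).
under eq_bigr do rewrite SE.
rewrite !big_ord_recl big_ord0 addr0 -!gfun_ofD //; last exact: polynomial_add.
congr gfun_of; apply/funext => x.
have d0 : (2 * l).+1%:R != 0 :> R[i] by rewrite pnatr_eq0.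
pose y := Ylm l m x.
have cAx : \sum_j xcoord j x * A j x = l%:R / (2 * l).+1%:R * y.
  have := congr1 (fun f => f x) cA.
  by rewrite /= !big_ord_recl !big_ord0.
(* The complement of [cAx]: since [sum_j x_j^2 = 1], both sums together give [y]. *)
have cBx : \sum_j xcoord j x * B j x = l.+1%:R / (2 * l).+1%:R * y.
  have -> : l.+1%:R / (2 * l).+1%:R * y = y - l%:R / (2 * l).+1%:R * y by field.
  rewrite -cAx -[y in RHS]mul1r -(sum_xcoord2 x) mulr_suml -sumrB.
  apply: eq_bigr => j _; rewrite -mulrA -mulrBr; congr (_ * _).
  have := congr1 (fun f => f x) (AB j).
  rewrite -[LHS]/(xcoord j x * y) -[RHS]/(A j x + B j x) => ->.
  by rewrite addrC addKr.
transitivity (s l.-1 * (\sum_j xcoord j x * A j x) + s l.+1 * (\sum_j xcoord j x * B j x)).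
  rewrite cAx cBx -[LHS]/(normal_eigenvalue s l * y) /normal_eigenvalue.
  (* At [l = 0] the term in [s l.-1 = s 0] has coefficient 0, leaving [s 1]. *)
  case: (l) => [|n]; first by field.
  by rewrite /= addn1; field.
rewrite !big_ord_recl !big_ord0.
set j0 := ord0; set j1 := lift _ _; set j2 := lift _ _.
rewrite -[RHS]/(xcoord j0 x * (s l.-1 * A j0 x + s l.+1 * B j0 x) +
  (xcoord j1 x * (s l.-1 * A j1 x + s l.+1 * B j1 x) +
   xcoord j2 x * (s l.-1 * A j2 x + s l.+1 * B j2 x))).
by ring.
Qed.
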